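(* Let $S=(X,P)$ be a stochastic approximation space, let $T:X\to P^*(X)$ be a set-valued mapping, and let $U$ be a random variable on $X$ with finitely many values $u_1,\dots,u_n$, $n\in\mathbb{N}$. For any real constants $a$ and $b$, there is a real number $d$ with $1\le d\le n$ such that $$\overline{E}(aU+b)=a\,\overline{E}(U)+bd .$$
   Context: $P^*(X)$ denotes the set of all non-empty subsets of a non-empty set $X$. A stochastic approximation space is a pair $S=(X,P)$ where $X$ is a non-empty set and $P$ is a probability measure on $X$. For a set-valued mapping $T:X\to P^*(X)$ and $A\subseteq X$, the upper inverse of $A$ is $T^{-1}(A)=\{x\in X : T(x)\cap A\neq\emptyset\}$. It is understood that $T^{-1}(A)$ is an event whenever $A$ is. The upper probability of an event $A$ is $\overline{P}(A)=P(T^{-1}(A))$. A random variable $U$ is a real-valued random variable on $X$ taking finitely many distinct values $u_1,\dots,u_n$, and $\overline{P}(U=u_k)=\overline{P}(\{x\in X: U(x)=u_k\})$. The upper expectation of $U$ is $\overline{E}(U)=\sum_{k=1}^n u_k\,\overline{P}(U=u_k)$, and for a function $g:\mathbb{R}\to\mathbb{R}$ the upper expectation of $g(U)$ is understood as $\overline{E}(g(U))=\sum_{k=1}^n g(u_k)\,\overline{P}(U=u_k)$. *)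

(* Defs.v *)
From HB Require Import structures.
From mathcomp Require Import all_boot all_order all_algebra.
From mathcomp Require Import all_classical all_reals all_analysis.

Set Implicit Arguments.
Unset Strict Implicit.
Unset Printing Implicit Defensive.

Import Order.TTheory GRing.Theory Num.Theory.

Local Open Scope classical_set_scope.
Local Open Scope ring_scope.

Definition upper_inverse (X : Type) (T : X -> set X) (A : set X) : set X :=
  [set x | T x `&` A !=set0].

(* A stochastic approximation space is a measurable space X with a probability
   P; the events are the measurable sets.  The last field is the standing
   convention that upper inverses of events are events. *)
Definition set_valued_mapping (d : measure_display) (X : measurableType d)
    (T : X -> set X) : Prop :=
  (forall x, T x !=set0) /\
  (forall A, measurable A -> measurable (upper_inverse T A)).

Definition upper_probability (d : measure_display) (X : measurableType d)
    (R : realType) (P : probability X R) (T : X -> set X) (A : set X) : \bar R :=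
  P (upper_inverse T A).

Definition enumerates_values (X : Type) (R : Type) (U : X -> R) (n : nat)
    (u : 'I_n -> R) : Prop :=
  injective u /\ range u = range U.

(* The two expectations below are meant for u enumerating the values of U;
   fine only converts the upper probabilities, which lie in [0, 1], to R. *)
Definition upper_expectation (d : measure_display) (X : measurableType d)
    (R : realType) (P : probability X R) (T : X -> set X) (U : {RV P >-> R})
    (n : nat) (u : 'I_n -> R) : R :=
  \sum_(k < n) u k * fine (upper_probability P T [set x | U x = u k]).

(* The upper expectation of g(U) sums over the values of U, not over those of
   g \o U, so values of U identified by g contribute separately. *)
Definition upper_expectation_comp (d : measure_display) (X : measurableType d)
    (R : realType) (P : probability X R) (T : X -> set X) (U : {RV P >-> R})
    (n : nat) (u : 'I_n -> R) (g : R -> R) : R :=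
  \sum_(k < n) g (u k) * fine (upper_probability P T [set x | U x = u k]).

(* Main.v *)
(* The number delta is the total upper probability of the level sets
   {U = u_k}. Each upper probability is at most 1, so delta <= n. Since every
   T x is non-empty and the level sets cover X, the upper inverses of the level
   sets also cover X, and subadditivity of P gives 1 <= delta. *)

Require Import Defs.
From mathcomp Require Import all_boot all_order all_algebra.
From mathcomp Require Import all_classical all_reals all_analysis.

Import Order.TTheory GRing.Theory Num.Theory.

Local Open Scope classical_set_scope.
Local Open Scope ring_scope.

(** A set meets a union exactly when it meets one of the members; this carries a cover of [X] over
    to the upper inverses. *)
Lemma upper_inverse_bigcup (X I : Type) (T : X -> set X) (D : set I)
    (A : I -> set X) :
  upper_inverse T (\bigcup_(i in D) A i) =
  \bigcup_(i in D) upper_inverse T (A i).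
Proof.
apply/seteqP; split=> [x [y [Txy [i Di Aiy]]]|x [i Di [y [Txy Aiy]]]].
  by exists i => //; exists y.
by exists y; split=> //; exists i.
Qed.

(** Non-emptiness of the values of [T] enters here: a point with empty value would lie in no upper
    inverse. *)
Lemma upper_inverse_setT (X : Type) (T : X -> set X) :
  (forall x, T x !=set0) -> upper_inverse T setT = setT.
Proof.
by move=> T0; apply/seteqP; split=> // x _; rewrite /upper_inverse /= setIT.
Qed.

Lemma enumerates_values_cover (X R : Type) (U : X -> R) (n : nat)
    (u : 'I_n -> R) :
  enumerates_values U u -> \bigcup_k [set x | U x = u k] = setT.
Proof.
move=> [_ uU]; apply/seteqP; split=> // x _.
have [k _ ukx] : range u (U x) by rewrite uU; exists x.
by exists k.
Qed.

(** Linearity of the sum in its coefficients. The weights need not add up to 1, so [b] is multiplied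
    by their total. *)
Lemma upper_expectation_affine (d : measure_display) (X : measurableType d)
    (R : realType) (P : probability X R) (T : X -> set X) (U : {RV P >-> R})
    (n : nat) (u : 'I_n -> R) (a b : R) :
  upper_expectation_comp T U u (fun y => a * y + b) =
  a * upper_expectation T U u +
  b * \sum_(k < n) fine (upper_probability P T [set x | U x = u k]).
Proof.
rewrite /upper_expectation_comp /upper_expectation !mulr_sumr -big_split /=.
by apply: eq_bigr => k _; rewrite mulrDl mulrA.
Qed.

Section UpperProbability.
Context (d : measure_display) (X : measurableType d) (R : realType).
Context (P : probability X R) (T : X -> set X) (hT : set_valued_mapping T).

Lemma upper_probability_fin_num (A : set X) :
  measurable A -> upper_probability P T A \is a fin_num.
Proof. by move=> mA; apply: fin_num_measure; apply: hT.2. Qed.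

Lemma fine_upper_probability_le1 (A : set X) :
  measurable A -> fine (upper_probability P T A) <= 1.
Proof.
move=> mA; rewrite -lee_fin fineK ?upper_probability_fin_num//.
by apply: probability_le1; apply: hT.2.
Qed.

(** Even for disjoint [A k] the upper inverses may overlap, so subadditivity gives only an
    inequality. *)
Lemma upper_probability_cover (n : nat) (A : 'I_n -> set X) :
  (forall k, measurable (A k)) -> \bigcup_k A k = setT ->
  1 <= \sum_(k < n) fine (upper_probability P T (A k)).
Proof.
move=> mA cA.
rewrite sum_fine => [|k _]; last exact: upper_probability_fin_num.
rewrite -lee_fin fineK; last first.
  by apply/sum_fin_numP => k _ _; exact: upper_probability_fin_num.
(* Read 1 as the measure of [X] and the sum as one over the finite index set [setT], the form
   required by finite subadditivity. *)
rewrite -(probability_setT P) bigfs ?index_enum_uniq//; last first.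
  by move=> k _; rewrite mem_index_enum.
rewrite set_true.
apply: content_sub_fsum => [|k _||]; [exact: finite_finset|exact: hT.2|by []|].
by rewrite -upper_inverse_bigcup cA upper_inverse_setT//; exact: hT.1.
Qed.

End UpperProbability.

Theorem theorem2p15 (d : measure_display) (X : measurableType d)
    (R : realType) (P : probability X R) (T : X -> set X)
    (hT : set_valued_mapping T) (U : {RV P >-> R})
    (n : nat) (u : 'I_n -> R) (hu : enumerates_values U u) (a b : R) :
  exists delta : R, 1 <= delta <= n%:R /\
    upper_expectation_comp T U u (fun y => a * y + b) =
    a * upper_expectation T U u + b * delta.
Proof.
have mU k : measurable [set x | U x = u k].
  exact: (measurable_funPTI U (measurable_set1 (u k))).
exists (\sum_(k < n) fine (upper_probability P T [set x | U x = u k])).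
split; last exact: upper_expectation_affine.
apply/andP; split.
  by apply: upper_probability_cover => //; exact: enumerates_values_cover hu.
(* Write [n] as a sum of [n] ones, to compare term by term. *)
rewrite -[n in n%:R]card_ord -sumr_const.
by apply: ler_sum => k _; exact: fine_upper_probability_le1.
Qed.
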